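(* The pair $(a^\ast,b^\ast)\in(-\infty,\hat x_2)\times(\hat x_1,\infty)$ is a global minimum of $C(a,b)$, and $C(a,b)\ge C(a^\ast,b^\ast)$ for all $-\infty<a<b<\infty$. Consequently, $\lambda\ge\lambda^\ast$ for all $-\infty<a<b<\infty$, where $\lambda=C(a,b)$ and $\lambda^\ast=C(a^\ast,b^\ast)$, and $Z^\ast_t=(U^{a^\ast}_t,D^{b^\ast}_t)$ constitutes an optimal singular control within the considered class of reflection policies.
   Context: Setting. On a complete filtered probability space with a Brownian motion $W$, the controlled process on $\mathbb{R}$ is $$dX^Z_t=\mu(X^Z_t)\,dt+\sigma(X^Z_t)\,dW_t+dU_t-dD_t,\qquad X^Z_0=x\in\mathbb{R},$$ where $\mu:\mathbb{R}\to\mathbb{R}$ is continuous, $\sigma:\mathbb{R}\to\mathbb{R}_+$ is continuous with $\sigma^2(x)>0$ for all $x\in\mathbb{R}$, and $x\mapsto(1+|\mu(x)|)/\sigma^2(x)$ is locally integrable. In $Z=(U,D)$ the admissible controls $U,D$ are non-negative, non-decreasing, right-continuous and adapted. The problem is to minimize the expected long run average costs $$\limsup_{T\to\infty}\frac1T\mathbb{E}_x\int_0^T\left(c(X^Z_s)\,ds+q_u\,dU_s+q_d\,dD_s\right).$$ The considered class of reflection policies consists of the admissible policies $(U^a_t,D^b_t)$, $-\infty<a<b<\infty$, which maintain the process between the constant thresholds $a$ and $b$; both are continuous on $t>0$ and increase only when $X^Z_t=a$ and $X^Z_t=b$, respectively. Notation. $S'(x)=\exp\left(-\int^x\frac{2\mu(y)}{\sigma^2(y)}dy\right)$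 (arbitrary fixed lower limit), $m'(x)=\frac{2}{\sigma^2(x)S'(x)}$, $m(a,b)=\int_a^b m'(t)\,dt$, and $$C(a,b)=\frac{1}{m(a,b)}\left[\int_a^b c(t)m'(t)\,dt+\frac{q_u}{S'(a)}+\frac{q_d}{S'(b)}\right],$$ which, for $x\in[a,b]$, is the long-run average cost of the policy $(U^a,D^b)$. Costs. $c:\mathbb{R}\to\mathbb{R}_+$ is continuous with $c(x)\ge c(0)\ge0$ for all $x$, and $q_u,q_d\in\mathbb{R}_+$ are constants. Put $\pi_1(x)=c(x)+q_d\mu(x)$ and $\pi_2(x)=c(x)-q_u\mu(x)$. Standing assumptions: (i) for $i=1,2$ there is a unique $\hat x_i=\operatorname{argmin}\{\pi_i(x)\}\in\mathbb{R}$ so that $\pi_i$ is decreasing on $(-\infty,\hat x_i)$ and increasing on $(\hat x_i,\infty)$; (ii) $\lim_{x\uparrow\infty}\pi_1(x)=\lim_{x\downarrow-\infty}\pi_2(x)=\infty$. The pair $(a^\ast,b^\ast)\in(-\infty,\hat x_2)\times(\hat x_1,\infty)$ is the uniquely determined solution (previously established to exist) of $$\int_{a}^{b}(\pi_1(t)-\pi_1(b))m'(t)\,dt+\frac{q_d+q_u}{S'(a)}=0,\qquad \int_{a}^{b}(\pi_2(t)-\pi_2(a))m'(t)\,dt+\frac{q_d+q_u}{S'(b)}=0.$$ *)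

(* Defs.v *)
From HB Require Import structures.
From mathcomp Require Import all_boot all_order all_algebra.
From mathcomp Require Import all_classical all_reals all_analysis.

Set Implicit Arguments.
Unset Strict Implicit.
Unset Printing Implicit Defensive.

Import Order.TTheory GRing.Theory Num.Theory.
Import numFieldNormedType.Exports.

Local Open Scope classical_set_scope.
Local Open Scope ring_scope.

Section diffusion_characteristics.
Context {R : realType}.
Implicit Types (f pi mu sigma c : R -> R) (qu qd x a b : R).

Definition oriented_integral (x0 : R) x f : R :=
  if x0 <= x then \int[lebesgue_measure]_(y in `[x0, x]) f y
  else - \int[lebesgue_measure]_(y in `[x, x0]) f y.

(* S', normalized by S'(x0) = 1 *)
Definition scale_density mu sigma (x0 : R) x : R :=
  expR (- oriented_integral x0 x (fun y => 2 * mu y / sigma y ^+ 2)).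

(* m' *)
Definition speed_density mu sigma (x0 : R) x : R :=
  2 / (sigma x ^+ 2 * scale_density mu sigma x0 x).

(* C(a, b); only meaningful for a < b *)
Definition average_cost mu sigma c qu qd (x0 : R) a b : R :=
  (\int[lebesgue_measure]_(t in `[a, b]) speed_density mu sigma x0 t)^-1 *
  (\int[lebesgue_measure]_(t in `[a, b]) (c t * speed_density mu sigma x0 t)
   + qu / scale_density mu sigma x0 a + qd / scale_density mu sigma x0 b).

Definition pi1 mu c qd x : R := c x + qd * mu x.
Definition pi2 mu c qu x : R := c x - qu * mu x.

Definition unique_argmin pi x : Prop :=
  (forall y, pi x <= pi y) /\
  (forall z, (forall y, pi z <= pi y) -> z = x).

Definition decreasing_then_increasing pi x : Prop :=
  (forall y z : R, y <= z -> z < x -> pi z <= pi y) /\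
  (forall y z : R, x < y -> y <= z -> pi y <= pi z).

(* The first-order system for the thresholds. As everywhere, a pair of
   thresholds is such that a < b. *)
Definition threshold_system mu sigma c qu qd (x0 : R) a b : Prop :=
  [/\ a < b,
      \int[lebesgue_measure]_(t in `[a, b])
        ((pi1 mu c qd t - pi1 mu c qd b) * speed_density mu sigma x0 t)
      + (qd + qu) / scale_density mu sigma x0 a = 0 &
      \int[lebesgue_measure]_(t in `[a, b])
        ((pi2 mu c qu t - pi2 mu c qu a) * speed_density mu sigma x0 t)
      + (qd + qu) / scale_density mu sigma x0 b = 0].

Definition global_minimum (C : R -> R -> R) a b : Prop :=
  a < b /\ forall a' b' : R, a' < b' -> C a b <= C a' b'.

End diffusion_characteristics.

Section stochastic_setting.
Context {R : realType} {d : measure_display} {T : measurableType d}.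
Variable P : probability T R.

(* Processes are indexed by R; only times t >= 0 matter, except for the
   controls (see admissible_control). *)
Implicit Types (F : R -> set (set T)) (W X U D H : R -> T -> R).

Record complete_filtration F : Prop := {
  filtration_sigma : forall t : R, 0 <= t -> sigma_algebra setT (F t) ;
  filtration_sub : forall (t : R) A, 0 <= t -> F t A -> measurable A ;
  filtration_homo : forall s t : R, 0 <= s -> s <= t -> F s `<=` F t ;
  filtration_complete : forall A, P.-negligible A -> F 0 A }.

Definition adapted F X : Prop :=
  forall t : R, 0 <= t -> forall B : set R, measurable B -> F t (X t @^-1` B).

(* normal_prob m s has mean m and standard deviation s *)
Record brownian_motion F W : Prop := {
  bm_adapted : adapted F W ;
  bm_start : {ae P, forall w, W 0 w = 0} ;
  bm_increment : forall s t : R, 0 <= s -> s < t ->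
    forall B : set R, measurable B ->
    P [set w | B (W t w - W s w)] = normal_prob 0 (Num.sqrt (t - s)) B ;
  bm_independent : forall s t : R, 0 <= s -> s < t ->
    forall (A : set T) (B : set R), F s A -> measurable B ->
    P (A `&` [set w | B (W t w - W s w)]) =
    (P A * P [set w | B (W t w - W s w)%R])%E ;
  bm_continuous : {ae P, forall w,
    {within `[0, +oo[, continuous (fun t => W t w)}} }.

Definition cvg_in_probability (Y : nat -> T -> R) (Z : T -> R) : Prop :=
  forall e : R, 0 < e ->
    P [set w | e <= `|Y n w - Z w|] @[n --> \oo] --> 0%E.

Definition ito_sum W H (t : R) (n : nat) (w : T) : R :=
  \sum_(i < n) H (i%:R / n%:R * t) w *
    (W (i.+1%:R / n%:R * t) w - W (i%:R / n%:R * t) w).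

(* I = \int_0^t H dW. For H adapted with right-continuous paths having left
   limits, the only integrands used below, the left-point Riemann sums converge
   in probability to the Ito integral. *)
Definition is_ito_integral W H (t : R) (I : T -> R) : Prop :=
  cvg_in_probability (ito_sum W H t) I.

Definition cadlag (f : R -> R) : Prop :=
  (forall t : R, 0 <= t -> f s @[s --> t^'+] --> f t) /\
  (forall t : R, 0 < t -> cvg (f s @[s --> t^'-])).

(* A control is extended by 0 to negative times, so that U 0 is its initial
   jump; together with monotonicity this makes it non-negative. *)
Record admissible_control F U : Prop := {
  control_adapted : adapted F U ;
  control_before : forall (t : R) w, t < 0 -> U t w = 0 ;
  control_nondecreasing : forall w (s t : R), s <= t -> U s w <= U t w ;
  control_right_continuous : forall w, right_continuous (fun t => U t w) }.

(* dX = mu(X) dt + sigma(X) dW + dU - dD with X_{0-} = x *)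
Record controlled_process (mu sigma : R -> R) F W (x : R) U D X : Prop := {
  state_adapted : adapted F X ;
  state_cadlag : forall w, cadlag (fun t => X t w) ;
  state_sde : forall t : R, 0 <= t ->
    is_ito_integral W (fun s w => sigma (X s w)) t
      (fun w => X t w - x
        - \int[lebesgue_measure]_(s in `[0, t]) mu (X s w)
        - (U t w - D t w)) }.

(* t belongs to the support of the Stieltjes measure du *)
Definition point_of_increase (u : R -> R) (t : R) : Prop :=
  forall e : R, 0 < e -> u (t - e) < u (t + e).

(* (U, D) = (U^a, D^b), with controlled process X started at x *)
Record reflection_policy (mu sigma : R -> R) F W (x a b : R) U D X : Prop := {
  reflection_lt : a < b ;
  reflection_up : admissible_control F U ;
  reflection_down : admissible_control F D ;
  reflection_state : controlled_process mu sigma F W x U D X ;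
  reflection_between : {ae P, forall w, forall t : R, 0 <= t -> a <= X t w <= b} ;
  reflection_continuous : {ae P, forall w, forall t : R, 0 < t ->
    {for t, continuous (fun s => U s w)} /\
    {for t, continuous (fun s => D s w)}} ;
  reflection_up_at : {ae P, forall w, forall t : R, 0 <= t ->
    point_of_increase (fun s => U s w) t -> X t w = a} ;
  reflection_down_at : {ae P, forall w, forall t : R, 0 <= t ->
    point_of_increase (fun s => D s w) t -> X t w = b} }.

(* The integral of the constant qu against dU over [0, S] is qu * U S, the
   initial jump included. *)
Definition expected_cost (c : R -> R) (qu qd : R) U D X (S : R) : \bar R :=
  (\int[P]_w (\int[lebesgue_measure]_(s in `[0%R, S]) c (X s w)
              + qu * U S w + qd * D S w)%:E)%E.

Definition long_run_cost (c : R -> R) (qu qd : R) U D X : \bar R :=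
  limf_esup (fun S : R => (S^-1)%:E * expected_cost c qu qd U D X S)%E
    (pinfty_nbhs R).

Definition optimal_among_reflections (mu sigma c : R -> R) (qu qd : R)
    F W (x : R) U D X : Prop :=
  (exists a b, reflection_policy mu sigma F W x a b U D X) /\
  forall a b U' D' X', reflection_policy mu sigma F W x a b U' D' X' ->
    (long_run_cost c qu qd U D X <= long_run_cost c qu qd U' D' X')%E.

End stochastic_setting.

(* Main.v *)
(** The drift identity [1/S'(b) - 1/S'(a) = ∫_a^b μ m'] turns the two threshold
    equations into [λ = π1(bstar) = π2(astar)], where [λ = C(astar, bstar)].
    The same identity gives, for all [a < b],
      [m(a, b) (C(a, b) - λ) = ∫_a^b (π1 - λ) m' + (qd + qu) / S'(a)
                             = ∫_a^b (π2 - λ) m' + (qd + qu) / S'(b)].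
    As a function of [b] the first form increases, decreases and increases
    again, the last turn being at [bstar]; so on [b >= a] it is minimal at
    [b = a], where it is nonnegative, or at [b = bstar]. The second form treats
    [a] in the same way with [b = bstar] fixed, and its value at
    [(astar, bstar)] is 0.

    A reflection policy started outside [[a, b]] differs, almost surely, from
    one started at a threshold only by an initial jump, whose cost is a constant
    and so vanishes in the long-run average. *)

Require Import Defs.
From HB Require Import structures.
From mathcomp Require Import all_boot all_order all_algebra.
From mathcomp Require Import all_classical all_reals all_analysis.
From mathcomp Require Import measurable_realfun lra ring.

Import Order.TTheory GRing.Theory Num.Theory.
Import numFieldNormedType.Exports.

Local Open Scope classical_set_scope.
Local Open Scope ring_scope.

(** * Integrals of continuous functions *)

Section continuous_integrals.
Context {R : realType}.
Implicit Types f h w : R -> R.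
Local Notation mu := lebesgue_measure.

Lemma continuous_itv_integrable f (a b : R) : continuous f ->
  mu.-integrable `[a, b] (EFin \o f).
Proof.
move=> cf; apply: continuous_compact_integrable; first exact: segment_compact.
exact: continuous_subspaceT.
Qed.

Lemma Rintegral_itvD f (a b e : R) : continuous f -> a <= b -> b <= e ->
  \int[mu]_(x in `[a, e]) f x =
  \int[mu]_(x in `[a, b]) f x + \int[mu]_(x in `[b, e]) f x.
Proof.
move=> cf ab be; apply/eqP; rewrite addrC -subr_eq; apply/eqP.
rewrite Rintegral_itvB ?bnd_simp//; last exact: continuous_itv_integrable.
rewrite Rintegral_itv_obnd_cbnd//.
apply: integrableS (continuous_itv_integrable f b e cf) => //.
exact: subset_itv_oc_cc.
Qed.

(** The minimum of [f] on the compact interval is attained, hence positive, and bounds the integral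
    from below. *)
Lemma Rintegral_gt0 f (a b : R) : continuous f -> a < b ->
  (forall x, 0 < f x) -> 0 < \int[mu]_(x in `[a, b]) f x.
Proof.
move=> cf ab f0.
have [e /= eab fe] : exists2 e, e \in `[a, b] &
    forall x, x \in `[a, b] -> f e <= f x.
  by apply: EVT_min; [exact: ltW|exact: continuous_subspaceT].
apply: (@lt_le_trans _ _ (\int[mu]_(x in `[a, b]) f e)).
  rewrite Rintegral_cst//= lebesgue_measure_itv/= lte_fin ab -EFinB/=.
  by rewrite mulr_gt0// subr_gt0.
apply: le_Rintegral => //.
- by apply: continuous_itv_integrable => x; exact: cvg_cst.
- exact: continuous_itv_integrable.
Qed.

(** A base point [l] to the left of both limits removes the case distinction on their order. *)
Lemma oriented_integralE f (x0 l x : R) : continuous f -> l <= x0 -> l <= x ->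
  oriented_integral x0 x f =
  \int[mu]_(y in `[l, x]) f y - \int[mu]_(y in `[l, x0]) f y.
Proof.
move=> cf lx0 lx; rewrite /oriented_integral; case: ifPn => [x0x|].
  by rewrite (Rintegral_itvD f l x0 x)// addrAC subrr add0r.
rewrite -ltNge => /ltW xx0.
by rewrite (Rintegral_itvD f l x x0)// opprD addrA subrr add0r.
Qed.

Lemma is_derive_oriented_integral f (x0 x : R) : continuous f ->
  is_derive x 1 (fun y => oriented_integral x0 y f) (f x).
Proof.
(* [l] is strictly left of [x0] and of [x], so the formula based at [l] holds on a whole
   neighbourhood of [x]. *)
move=> cf; pose l := Num.min x0 x - 1.
have lx0 : l < x0 by rewrite /l ltrBlDr (@le_lt_trans _ _ x0) ?ltrDl// ge_min lexx.
have lx : l < x.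
  by rewrite /l ltrBlDr (@le_lt_trans _ _ x) ?ltrDl// ge_min lexx orbT.
pose G y := \int[mu]_(t in `[l, y]) f t.
have [dG G'] : derivable G x 1 /\ derive1 G x = f x.
  apply: (@continuous_FTC1_closed _ f l x (x + 1)) => //.
  - by rewrite ltrDl.
  - exact: continuous_itv_integrable.
  - exact: cf.
have iG : is_derive x 1 G (f x) by apply: DeriveDef => //; rewrite -derive1E.
apply: (@near_eq_is_derive _ _ _ (fun y => G y - G x0)).
  near=> y; have ly : l < y by near: y; exact: lt_nbhsr.
  by rewrite (oriented_integralE f x0 l) ?ltW.
have -> : f x = f x - 0 by rewrite subr0.
exact: is_deriveB.
Unshelve. all: by end_near. Qed.

(** Before [beta], once [h] is nonpositive it stays so. If [b < beta] and [h b <= 0], extending the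
    interval to [beta] adds a nonpositive amount; if [h b > 0], then [h > 0] on all of [[a, b]]. If
    [b] lies beyond [beta], cutting back to [beta] drops a nonnegative amount. *)
Lemma Rintegral_right_threshold h w (a b beta : R) :
  continuous h -> continuous w -> (forall t, 0 <= w t) ->
  (forall t, beta <= t -> 0 <= h t) ->
  (forall s t, s <= t <= beta -> h t <= Num.max (h s) 0) ->
  a <= b ->
  0 <= \int[mu]_(t in `[a, b]) (h t * w t) \/
  (a <= beta /\ \int[mu]_(t in `[a, beta]) (h t * w t) <=
                \int[mu]_(t in `[a, b]) (h t * w t)).
Proof.
move=> ch cw w0 hge hqc ab.
have chw : continuous (fun t => h t * w t).
  by move=> t; apply: cvgM; [exact: ch|exact: cw].
have [betaa|abeta] := leP beta a.
  left; apply: Rintegral_ge0 => t /=; rewrite in_itv/= => /andP[at_ _].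
  by rewrite mulr_ge0// hge// (le_trans betaa).
have [betab|bbeta] := leP beta b.
  right; split; first exact: ltW.
  rewrite (Rintegral_itvD _ a beta b chw (ltW abeta) betab) lerDl.
  apply: Rintegral_ge0 => t /=; rewrite in_itv/= => /andP[at_ _].
  by rewrite mulr_ge0// hge.
have [hb|hb] := leP (h b) 0; [right; split; first exact: ltW|left].
  rewrite (Rintegral_itvD _ a b beta chw ab (ltW bbeta)) gerDl.
  rewrite -oppr_ge0 -mulN1r -RintegralZl//; last first.
    exact: continuous_itv_integrable.
  apply: Rintegral_ge0 => t /=; rewrite in_itv/= => tb.
  rewrite mulN1r -mulNr mulr_ge0// oppr_ge0.
  by rewrite (le_trans (hqc b t tb))// ge_max hb lexx.
apply: Rintegral_ge0 => t /=; rewrite in_itv/= => /andP[_ tb].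
rewrite mulr_ge0//.
have := hqc t b; rewrite tb ltW// => /(_ isT).
by rewrite le_max => /orP[|]; lra.
Qed.

(** Mirror image of the preceding argument, moving the left endpoint to [alpha]. *)
Lemma Rintegral_left_threshold h w (a b alpha : R) :
  continuous h -> continuous w -> (forall t, 0 <= w t) ->
  (forall t, t <= alpha -> 0 <= h t) ->
  (forall s t, alpha <= t <= s -> h t <= Num.max (h s) 0) ->
  a <= b ->
  0 <= \int[mu]_(t in `[a, b]) (h t * w t) \/
  (alpha <= b /\ \int[mu]_(t in `[alpha, b]) (h t * w t) <=
                 \int[mu]_(t in `[a, b]) (h t * w t)).
Proof.
move=> ch cw w0 hge hqc ab.
have chw : continuous (fun t => h t * w t).
  by move=> t; apply: cvgM; [exact: ch|exact: cw].
have [balpha|alphab] := leP b alpha.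
  left; apply: Rintegral_ge0 => t /=; rewrite in_itv/= => /andP[_ tb].
  by rewrite mulr_ge0// hge// (le_trans tb).
have [aalpha|alphaa] := leP a alpha.
  right; split; first exact: ltW.
  rewrite (Rintegral_itvD _ a alpha b chw aalpha (ltW alphab)) lerDr.
  apply: Rintegral_ge0 => t /=; rewrite in_itv/= => /andP[_ ta].
  by rewrite mulr_ge0// hge.
have [ha|ha] := leP (h a) 0; [right; split; first exact: ltW|left].
  rewrite (Rintegral_itvD _ alpha a b chw (ltW alphaa) ab) gerDr.
  rewrite -oppr_ge0 -mulN1r -RintegralZl//; last first.
    exact: continuous_itv_integrable.
  apply: Rintegral_ge0 => t /=; rewrite in_itv/= => ta.
  rewrite mulN1r -mulNr mulr_ge0// oppr_ge0.
  by rewrite (le_trans (hqc a t ta))// ge_max ha lexx.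
apply: Rintegral_ge0 => t /=; rewrite in_itv/= => /andP[at_ _].
rewrite mulr_ge0//.
have := hqc t a; rewrite at_ ltW// => /(_ isT).
by rewrite le_max => /orP[|]; lra.
Qed.

End continuous_integrals.

(** * Minimality of the threshold pair *)

Section scale_and_speed.
Context {R : realType}.
Variables mu sigma : R -> R.
Hypothesis mu_cont : continuous mu.
Hypothesis sigma_cont : continuous sigma.
Hypothesis sigma2_gt0 : forall x, 0 < sigma x ^+ 2.
Variable x0 : R.
Local Notation leb := lebesgue_measure.
Local Notation S' := (scale_density mu sigma x0).
Local Notation m' := (speed_density mu sigma x0).

Let drift_ratio x := 2 * mu x / sigma x ^+ 2.

Let sigma2_cont : continuous (fun x => sigma x ^+ 2).
Proof. by move=> x; exact: (cvgM (sigma_cont x) (sigma_cont x)). Qed.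

Let drift_ratio_cont : continuous drift_ratio.
Proof.
move=> x; apply: cvgM.
  by apply: cvgM; [exact: cvg_cst|exact: mu_cont].
by apply: cvgV; [rewrite gt_eqF|exact: sigma2_cont].
Qed.

Lemma scale_density_gt0 x : 0 < S' x.
Proof. exact: expR_gt0. Qed.

Let invr_scaleE x : (S' x)^-1 = expR (oriented_integral x0 x drift_ratio).
Proof. by rewrite /scale_density expRN invrK. Qed.

Let speed_densityE x : m' x = 2 / sigma x ^+ 2 * (S' x)^-1.
Proof. by rewrite /speed_density invfM mulrA. Qed.

Lemma speed_density_gt0 x : 0 < m' x.
Proof.
by rewrite divr_gt0// mulr_gt0// scale_density_gt0.
Qed.

(** [1 / S'] is the exponential of the integral of [2 mu / sigma^2], and
    [m' = (2 / sigma^2) / S']. *)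
Lemma is_derive_invr_scale (x : R) :
  is_derive x 1 (fun y => (S' y)^-1) (mu x * m' x).
Proof.
rewrite (_ : (fun _ => _) = expR \o (fun y => oriented_integral x0 y drift_ratio)).
  rewrite speed_densityE invr_scaleE.
  rewrite (_ : mu x * _ =
     expR (oriented_integral x0 x drift_ratio) * drift_ratio x).
    apply: is_derive1_comp; exact: is_derive_oriented_integral.
  by rewrite /drift_ratio; ring.
by apply/funext => y; rewrite invr_scaleE.
Qed.

Let invr_scale_cont : continuous (fun x => (S' x)^-1).
Proof.
move=> x; apply: differentiable_continuous; apply/derivable1_diffP.
by have [] := is_derive_invr_scale x.
Qed.

Lemma continuous_speed_density : continuous m'.
Proof.
move=> x; rewrite (_ : m' = fun y => 2 / sigma y ^+ 2 * (S' y)^-1); last first.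
  by apply/funext => y; rewrite speed_densityE.
apply: cvgM; last exact: invr_scale_cont.
apply: cvgM; first exact: cvg_cst.
by apply: cvgV; [rewrite gt_eqF|exact: sigma2_cont].
Qed.

Lemma Rintegral_drift_speed (a b : R) : a < b ->
  \int[leb]_(t in `[a, b]) (mu t * m' t) = (S' b)^-1 - (S' a)^-1.
Proof.
move=> ab; rewrite /Rintegral.
rewrite (@continuous_FTC2 _ _ (fun y => (S' y)^-1))//.
- apply: continuous_subspaceT => x.
  by apply: cvgM; [exact: mu_cont|exact: continuous_speed_density].
- split.
  + by move=> x _; have [] := is_derive_invr_scale x.
  + by apply: cvg_at_right_filter; exact: invr_scale_cont.
  + by apply: cvg_at_left_filter; exact: invr_scale_cont.
- by move=> x _; rewrite derive1E; have [] := is_derive_invr_scale x.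
Qed.

Section costs.
Variables (c : R -> R) (qu qd : R).
Hypothesis c_cont : continuous c.
Local Notation pi1 := (pi1 mu c qd).
Local Notation pi2 := (pi2 mu c qu).
Local Notation C := (average_cost mu sigma c qu qd x0).

Lemma continuous_pi1 : continuous pi1.
Proof.
move=> x; apply: cvgD; first exact: c_cont.
by apply: cvgM; [exact: cvg_cst|exact: mu_cont].
Qed.

Lemma continuous_pi2 : continuous pi2.
Proof.
move=> x; apply: cvgB; first exact: c_cont.
by apply: cvgM; [exact: cvg_cst|exact: mu_cont].
Qed.

Let speed_int_gt0 (a b : R) : a < b -> 0 < \int[leb]_(t in `[a, b]) m' t.
Proof.
move=> ab; apply: Rintegral_gt0 => //; first exact: continuous_speed_density.
exact: speed_density_gt0.
Qed.

(** Both cost functions are instances with [f = c]: [q = qd] gives [pi1] and [q = - qu] gives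
    [pi2]. *)
Let Rintegral_drift (f : R -> R) (q l a b : R) : continuous f -> a < b ->
  \int[leb]_(t in `[a, b]) ((f t + q * mu t - l) * m' t) =
  \int[leb]_(t in `[a, b]) (f t * m' t) + q * ((S' b)^-1 - (S' a)^-1)
  - l * \int[leb]_(t in `[a, b]) m' t.
Proof.
move=> cf ab; rewrite -(Rintegral_drift_speed a b)//.
have cm := continuous_speed_density.
have cM (g : R -> R) : continuous g -> continuous (fun t => g t * m' t).
  by move=> cg t; apply: cvgM; [exact: cg|exact: cm].
have ci (g : R -> R) : continuous g -> leb.-integrable `[a, b] (EFin \o g).
  exact: continuous_itv_integrable.
have cZ (r : R) (g : R -> R) : continuous g -> continuous (fun t => r * g t).
  by move=> cg t; apply: cvgM; [exact: cvg_cst|exact: cg].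
rewrite -!RintegralZl//; [|exact/ci/cm|exact/ci/cM].
rewrite -RintegralD//; [|exact/ci/cM|exact: (ci _ (cZ q _ (cM mu mu_cont)))].
rewrite -RintegralB//; first by apply: eq_Rintegral => t _; ring.
  by apply: ci => t; apply: cvgD; [exact: cM|exact: (cZ q _ (cM mu mu_cont))].
exact: (ci _ (cZ l _ cm)).
Qed.

(** The drift identity trades [qd / S' b] for [qd / S' a]. The level [l] is left free: it is [pi1 b]
    when the threshold equations are read, and the optimal cost in the minimality proof. *)
Lemma Rintegral_pi1 (l a b : R) : a < b ->
  \int[leb]_(t in `[a, b]) ((pi1 t - l) * m' t) + (qd + qu) / S' a =
  (C a b - l) * \int[leb]_(t in `[a, b]) m' t.
Proof.
move=> ab; rewrite /pi1 Rintegral_drift// /average_cost.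
move: (scale_density_gt0 a) (scale_density_gt0 b) (speed_int_gt0 a b ab).
move: (S' a) (S' b) (\int[leb]_(t in _) m' t) => sa sb m sa0 sb0 m0.
by field; rewrite !gt_eqF.
Qed.

Lemma Rintegral_pi2 (l a b : R) : a < b ->
  \int[leb]_(t in `[a, b]) ((pi2 t - l) * m' t) + (qd + qu) / S' b =
  (C a b - l) * \int[leb]_(t in `[a, b]) m' t.
Proof.
move=> ab; rewrite /pi2.
under eq_Rintegral do rewrite -mulNr.
rewrite Rintegral_drift// /average_cost.
move: (scale_density_gt0 a) (scale_density_gt0 b) (speed_int_gt0 a b ab).
move: (S' a) (S' b) (\int[leb]_(t in _) m' t) => sa sb m sa0 sb0 m0.
by field; rewrite !gt_eqF.
Qed.

(** At levels [pi1 b] and [pi2 a] the two equations say that [C a b - l] times a positive speed mass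
    is zero. *)
Lemma threshold_system_cost (a b : R) :
  threshold_system mu sigma c qu qd x0 a b ->
  [/\ a < b, C a b = pi1 b & C a b = pi2 a].
Proof.
move=> [ab]; rewrite Rintegral_pi1// Rintegral_pi2// => /eqP + /eqP.
rewrite !mulf_eq0 !subr_eq0 !(gt_eqF (speed_int_gt0 _ _ ab)) !orbF.
by move=> /eqP + /eqP.
Qed.

End costs.
End scale_and_speed.

Section minimality.
Context {R : realType}.
Implicit Types f : R -> R.

(** Quasiconvexity. The shape hypothesis is silent at [x] itself; there minimality takes over. *)
Lemma decreasing_then_increasing_le_max f (x s t u : R) :
  unique_argmin f x -> decreasing_then_increasing f x ->
  s <= t <= u -> f t <= Num.max (f s) (f u).
Proof.
move=> [fx _] [fl fr] /andP[st tu]; rewrite le_max.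
have [tx|xt|->] := ltgtP t x.
- by rewrite fl.
- by rewrite (fr t u)// orbT.
- by rewrite fx.
Qed.

Lemma average_cost_min (mu sigma c : R -> R) (qu qd x0 xh1 xh2 astar bstar : R) :
  continuous mu -> continuous sigma -> (forall x, 0 < sigma x ^+ 2) ->
  continuous c -> 0 <= qu -> 0 <= qd ->
  unique_argmin (pi1 mu c qd) xh1 -> unique_argmin (pi2 mu c qu) xh2 ->
  decreasing_then_increasing (pi1 mu c qd) xh1 ->
  decreasing_then_increasing (pi2 mu c qu) xh2 ->
  astar < xh2 -> xh1 < bstar ->
  threshold_system mu sigma c qu qd x0 astar bstar ->
  global_minimum (average_cost mu sigma c qu qd x0) astar bstar.
Proof.
move=> mu_cont sigma_cont sigma2_gt0 c_cont qu0 qd0 am1 am2 di1 di2 ax bx sys.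
have [ab E1 E2] := threshold_system_cost mu sigma mu_cont sigma_cont sigma2_gt0
  x0 c qu qd c_cont _ _ sys.
split; [exact: ab|move=> a b altb].
set l := average_cost _ _ _ _ _ _ _ _ in E1 E2 *.
pose m' := speed_density mu sigma x0.
have m'0 t : 0 <= m' t by rewrite ltW// speed_density_gt0.
have cm' : continuous m' by exact: continuous_speed_density.
pose h1 t := pi1 mu c qd t - l; pose h2 t := pi2 mu c qu t - l.
have ch1 : continuous h1.
  by move=> t; apply: cvgB; [exact: continuous_pi1|exact: cvg_cst].
have ch2 : continuous h2.
  by move=> t; apply: cvgB; [exact: continuous_pi2|exact: cvg_cst].
have h1ge t : bstar <= t -> 0 <= h1 t.
  by move=> bt; rewrite subr_ge0 E1; apply: (proj2 di1).
have h2ge t : t <= astar -> 0 <= h2 t.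
  by move=> ta; rewrite subr_ge0 E2; apply: (proj1 di2).
(* Quasiconvexity between [s] and [bstar], where [h1] vanishes because [pi1 bstar = l]. *)
have h1qc s t : s <= t <= bstar -> h1 t <= Num.max (h1 s) 0.
  move=> /(decreasing_then_increasing_le_max _ _ _ _ _ am1 di1).
  by rewrite -E1 /h1 !le_max subr_le0 lerD2r.
have h2qc s t : astar <= t <= s -> h2 t <= Num.max (h2 s) 0.
  move=> /(decreasing_then_increasing_le_max _ _ _ _ _ am2 di2).
  by rewrite -E2 /h2 !le_max subr_le0 lerD2r orbC.
have p0 x : 0 <= (qd + qu) / scale_density mu sigma x0 x.
  by rewrite divr_ge0 ?addr_ge0// ltW// scale_density_gt0.
(* For [u < v], [G u v] is the excess cost [C u v - l] times the speed mass; unlike [C], it also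
   makes sense at [u = v]. *)
pose G u v := \int[lebesgue_measure]_(t in `[u, v]) (h1 t * m' t)
  + (qd + qu) / scale_density mu sigma x0 u.
have GE u v : u < v -> G u v = \int[lebesgue_measure]_(t in `[u, v]) (h2 t * m' t)
  + (qd + qu) / scale_density mu sigma x0 v.
  by move=> uv; rewrite /G Rintegral_pi1// -Rintegral_pi2.
have G0 : G astar bstar = 0.
  by rewrite /G Rintegral_pi1// -/l subrr mul0r.
(* The case [u = bstar] is included because moving [b] to [bstar] may collapse the interval; only
   the nonnegative boundary term is left then. Otherwise [u] is moved to [astar]. *)
have Gb u : u <= bstar -> 0 <= G u bstar.
  rewrite le_eqVlt => /predU1P[->|ub].
    by rewrite /G set_itv1 Rintegral_set1 add0r.
  rewrite GE//.
  have [i0|[_ i0]] := Rintegral_left_threshold h2 m' u bstar astar ch2 cm' m'0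
    h2ge h2qc (ltW ub).
    by rewrite addr_ge0.
  by rewrite -[leLHS]G0 GE// lerD2r.
have : 0 <= G a b.
  have [i0|[abstar i0]] := Rintegral_right_threshold h1 m' a b bstar ch1 cm' m'0
    h1ge h1qc (ltW altb).
    by rewrite addr_ge0.
  by rewrite (le_trans (Gb _ abstar))// lerD2r.
have m0 : 0 < \int[lebesgue_measure]_(t in `[a, b]) m' t.
  by apply: Rintegral_gt0 => // t; exact: speed_density_gt0.
rewrite /G Rintegral_pi1; [|by []..].
rewrite (pmulr_lge0 _ m0) subr_ge0; exact: id.
Qed.

End minimality.

(** * Comparison of integrals and upper limits; closure of sigma-algebras *)

Section nonneg_integral.
Context {R : realType} {d : measure_display} {T : measurableType d}.
Local Open Scope ereal_scope.
Import HBNNSimple.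

(* No measurability is assumed: the integral of a nonnegative function is a
   supremum over the simple functions below it. *)
Lemma ge0_le_integralT (mu : {measure set T -> \bar R}) (f g : T -> \bar R) :
  (forall w, 0 <= f w) -> (forall w, f w <= g w) ->
  \int[mu]_w f w <= \int[mu]_w g w.
Proof.
move=> f0 fg; have g0 w : 0 <= g w by exact: le_trans (fg w).
rewrite !ge0_integralTE//; apply: le_ereal_sup => _ [h /= hf <-].
by exists h => // w; exact: le_trans (fg w).
Qed.

(** Neither [f] nor [g] is assumed measurable, so the integral of [g + k] cannot be split directly.
    Each simple function [h] below [f] is treated instead: the positive part of [h - k] is
    measurable and lies below [g] on [J]. *)
Lemma ae_le_integral_addcst (P : probability T R) (J : set T)
    (f g : T -> \bar R) (k : R) :
  measurable J -> P (~` J) = 0 -> (0 <= k)%R ->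
  (forall w, 0 <= f w) -> (forall w, 0 <= g w) ->
  (forall w, J w -> f w <= g w + k%:E) ->
  \int[P]_w f w <= \int[P]_w g w + k%:E.
Proof.
move=> mJ PJ k0 f0 g0 fg; rewrite [leLHS]ge0_integralTE//.
apply: ge_ereal_sup => _ [h /= hf <-].
have -> : sintegral P h = \int[P]_w (h w)%:E.
  by rewrite integral_nnsfun// patch_setT.
have mh : measurable_fun setT (EFin \o h) by exact/measurable_EFinP.
pose g1 w := (Num.max (h w - k) 0)%:E.
have g10 w : 0 <= g1 w by rewrite lee_fin le_max lexx orbT.
have mg1 : measurable_fun setT g1.
  apply/measurable_EFinP; apply: measurable_maxr => //.
  exact: measurable_funB.
rewrite (ge0_negligible_integral _ _ _ _ PJ)//; last 2 first.
  exact: measurableC.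
  by move=> w _; rewrite lee_fin.
rewrite setTD setCK.
apply: (@le_trans _ _ (\int[P]_(w in J) (g1 w + k%:E))).
  apply: ge0_le_integral => //.
  - by move=> w _; rewrite lee_fin.
  - exact: measurable_funTS.
  - apply: emeasurable_funD => //; exact: measurable_funTS.
  - move=> w _; rewrite -EFinD lee_fin -lerBlDr le_max lexx//.
rewrite ge0_integralD//; last exact: measurable_funTS.
apply: leeD.
  rewrite integral_mkcond; apply: ge0_le_integralT => w.
    by rewrite patchE; case: ifP.
  rewrite patchE; case: ifPn => // /set_mem Jw.
  rewrite /g1 EFin_max ge_max; apply/andP; split => //.
  rewrite EFinB leeBlDr//.
  exact: le_trans (hf w) (fg w Jw).
rewrite integral_cst// -[leRHS]mule1; apply: lee_wpmul2l; first by rewrite lee_fin.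
exact: probability_le1.
Qed.

End nonneg_integral.

(** The upper limit is an infimum of suprema over the sets of the filter; each such set may be
    shrunk to where the bound with [e] holds. *)
Lemma le_limf_esup_near {R : realType} (f g : R -> \bar R) :
  (forall e : R, 0 < e -> \forall x \near pinfty_nbhs R, (f x <= g x + e%:E)%E) ->
  (limf_esup f (pinfty_nbhs R) <= limf_esup g (pinfty_nbhs R))%E.
Proof.
move=> fg; apply: le_ereal_inf_tmp => _ [A FA <-]; apply/lee_addgt0Pr => e e0.
apply: ge_ereal_inf.
exists (ereal_sup (f @` (A `&` [set x | (f x <= g x + e%:E)%E]))).
  by exists (A `&` [set x | (f x <= g x + e%:E)%E]) => //; exact: filterI FA (fg e e0).
apply: ge_ereal_sup => _ [x [Ax fgx] <-]; apply: le_trans fgx _.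
by rewrite leeD2r// ereal_sup_ubound//; exists x.
Qed.

Section sigma_algebra_closure.
Context {T : Type} (G : set (set T)).
Hypothesis G_sigma : sigma_algebra setT G.

Lemma sigma_algebra_setC A : G A -> G (~` A).
Proof. by move=> GA; rewrite -setTD; case: G_sigma => _ + _; exact. Qed.

Lemma sigma_algebra_setU A B : G A -> G B -> G (A `|` B).
Proof.
move=> GA GB; case: G_sigma => G0 _ GU; rewrite -bigcup2E; apply: GU.
by move=> [|[|n]].
Qed.

Lemma sigma_algebra_setI A B : G A -> G B -> G (A `&` B).
Proof.
move=> GA GB; rewrite -[A `&` B]setCK setCI.
by apply/sigma_algebra_setC/sigma_algebra_setU; exact: sigma_algebra_setC.
Qed.

End sigma_algebra_closure.

(** * Starting points outside the reflection interval *)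

Section shifted_controls.
Context {R : realType} {d : measure_display} {T : measurableType d}.
Variable P : probability T R.
Implicit Types (F : R -> set (set T)) (W X U D : R -> T -> R) (J : set T).

(* Starting from outside [a, b], a reflection policy makes an immediate jump of
   size k. Removing it gives a policy started in [a, b] which drives the same
   state process; J is the almost sure event that the jump is at least k. Off J
   the other control is raised instead, so that U - D changes by the same
   constant for every w and the stochastic equation is literally unchanged. *)
Definition shift_control J (k k' : R) U (t : R) (w : T) : R :=
  if t < 0 then 0 else if w \in J then U t w - k else U t w + k'.

Lemma control_ge0 F U : admissible_control F U -> forall t w, 0 <= U t w.
Proof.
move=> aU t w; have [t0|t0] := ltP t 0; first by rewrite (control_before aU).
rewrite -(control_before aU (t := -1) w) ?oppr_lt0//.
by apply: (control_nondecreasing aU); rewrite (le_trans _ t0)// lerN10.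
Qed.

(** On [J] only the increment across time 0 changes: it drops by [k], and stays nonnegative since
    [k <= U 0 w]. *)
Lemma shift_control_incr F U J (k k' s t : R) w : admissible_control F U ->
  0 <= k -> J `<=` [set w | k <= U 0 w] -> J w -> s <= t ->
  0 <= shift_control J k k' U t w - shift_control J k k' U s w <= U t w - U s w.
Proof.
move=> aU k0 JU Jw st; rewrite /shift_control (mem_set Jw).
have mono := control_nondecreasing aU w.
have kU : k <= U 0 w := JU w Jw.
case: (ltP s 0) => s0; case: (ltP t 0) => t0.
- by rewrite subrr lexx subr_ge0 mono.
- by rewrite subr0 (control_before aU (t := s))//; have := mono _ _ t0; lra.
- by move: (le_lt_trans st t0); rewrite ltNge s0.
- by have := mono _ _ st; lra.
Qed.

Lemma shift_control_point F U J (k k' t : R) w : admissible_control F U ->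
  0 <= k -> J `<=` [set w | k <= U 0 w] -> J w ->
  point_of_increase (fun s => shift_control J k k' U s w) t ->
  point_of_increase (fun s => U s w) t.
Proof.
move=> aU k0 JU Jw inc e e0; have := inc e e0.
have te : t - e <= t + e by lra.
have := shift_control_incr F U J k k' _ _ w aU k0 JU Jw te; lra.
Qed.

(** Reduces path regularity at nonnegative times to translation by a constant depending on [w]
    only. *)
Lemma shift_control_translate U J (k k' : R) w : exists q : R,
  forall s, 0 <= s -> shift_control J k k' U s w = U s w + q.
Proof.
rewrite /shift_control; case: (w \in J); [exists (- k)|exists k'];
  by move=> s s0; rewrite ltNge s0.
Qed.

Lemma shift_control_continuous U J (k k' t : R) w : 0 < t ->
  {for t, continuous (fun s => U s w)} ->
  {for t, continuous (fun s => shift_control J k k' U s w)}.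
Proof.
move=> t0 cU; have [q qE] := shift_control_translate U J k k' w.
rewrite /prop_for /continuous_at qE ?ltW//.
have : U s w + q @[s --> t] --> U t w + q.
  by apply: cvgD; [exact: cU|exact: cvg_cst].
apply: cvg_trans.
apply: (near_eq_cvg (F := nbhs t)); near=> s; rewrite qE// ltW//; near: s.
exact: lt_nbhsr.
Unshelve. all: by end_near. Qed.

Lemma shift_control_right_continuous F U J (k k' : R) w :
  admissible_control F U ->
  right_continuous (fun t => shift_control J k k' U t w).
Proof.
move=> aU t; have [t0|t0] := ltP t 0.
  rewrite {2}/shift_control t0; apply: cvg_near_cst.
  near=> s; rewrite /shift_control ifT//; near: s.
have [q qE] := shift_control_translate U J k k' w; rewrite qE//.
have : U s w + q @[s --> t^'+] --> U t w + q.
  by apply: cvgD; [exact: (control_right_continuous aU)|exact: cvg_cst].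
apply: cvg_trans.
apply: (near_eq_cvg (F := t^'+)); near=> s; rewrite qE// (le_trans t0)//; near: s.
Unshelve. all: by end_near. Qed.

Lemma shift_control_admissible F U J (k k' : R) :
  complete_filtration P F -> F 0 J ->
  J `<=` [set w | k <= U 0 w] -> 0 <= k -> 0 <= k' ->
  admissible_control F U -> admissible_control F (shift_control J k k' U).
Proof.
move=> cF FJ JU k0 k'0 aU; split.
- move=> t t0 B mB; have sF := filtration_sigma cF t0.
  have FtJ : F t J by exact: (filtration_homo cF (lexx 0) t0).
  have mBD (r : R) : measurable ((fun y => y + r) @^-1` B).
    rewrite -[_ @^-1` _]setTI; apply: measurable_funD => //.
  (* The preimage is split along [J], which belongs to [F 0] and hence to [F t]. *)
  rewrite (_ : _ @^-1` B = (J `&` U t @^-1` ((fun y => y - k) @^-1` B)) `|`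
     (~` J `&` U t @^-1` ((fun y => y + k') @^-1` B))); last first.
    apply/seteqP; split => w /=; rewrite /shift_control ltNge t0/=.
      by case: ifPn => [/set_mem|/negP wJ]; [left|right; split=> // /mem_set].
    by move=> [[/mem_set ->]|[wJ]] //; rewrite ifN//; apply/negP => /set_mem.
  apply: sigma_algebra_setU => //; apply: sigma_algebra_setI => //.
  + exact: (control_adapted aU).
  + exact: sigma_algebra_setC.
  + exact: (control_adapted aU).
- by move=> t w t0; rewrite /shift_control t0.
- move=> w s t st; have [Jw|nJw] := pselect (J w).
    have := shift_control_incr F U J k k' _ _ w aU k0 JU Jw st; lra.
  rewrite /shift_control (memNset nJw).
  have mono := control_nondecreasing aU w; have U0 := control_ge0 _ _ aU t w.
  case: (ltP s 0) => s0; case: (ltP t 0) => t0 //.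
  + by rewrite addr_ge0.
  + by move: (le_lt_trans st t0); rewrite ltNge s0.
  + by rewrite lerD2r mono.
- by move=> w; exact: shift_control_right_continuous aU.
Qed.

Lemma adapted_measurable F X (t : R) : complete_filtration P F ->
  adapted F X -> 0 <= t -> measurable_fun setT (X t).
Proof.
by move=> cF aX t0 _ B mB; rewrite setTI; apply: (filtration_sub cF t0); exact: aX.
Qed.

(** At [t = 0] every Ito sum and the drift integral vanish. A constant sequence then converges in
    probability to the defect [Z], so [Z = 0] almost surely. *)
Lemma state_at_0 (mu sigma : R -> R) F W (x : R) U D X :
  complete_filtration P F -> admissible_control F U -> admissible_control F D ->
  controlled_process P mu sigma F W x U D X ->
  {ae P, forall w, X 0 w = x + U 0 w - D 0 w}.
Proof.
move=> cF aU aD sX; pose Z w := X 0 w - x - (U 0 w - D 0 w).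
have mX : measurable_fun setT (X 0).
  exact: (adapted_measurable F X 0 cF (state_adapted sX)).
have mU : measurable_fun setT (U 0).
  exact: (adapted_measurable F U 0 cF (control_adapted aU)).
have mD : measurable_fun setT (D 0).
  exact: (adapted_measurable F D 0 cF (control_adapted aD)).
have mZ : measurable_fun setT Z.
  by apply: measurable_funB; apply: measurable_funB => //; exact: measurable_cst.
have mA (e : R) : measurable [set w | e <= `|Z w|].
  rewrite (_ : [set w | _] = setT `&` (fun w => `|Z w|) @^-1` `[e, +oo[).
    by apply: measurableT_comp.
  by apply/seteqP; split => w /=; rewrite in_itv/= andbT => // -[].
have PA (e : R) : 0 < e -> P [set w | e <= `|Z w|] = 0%E.
  move=> e0; have := state_sde sX (lexx 0) e0.
  rewrite (_ : (fun n => _) = fun=> P [set w | e <= `|Z w|]); last first.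
    apply/funext => n; congr (P _); apply/funext => w /=.
    rewrite /ito_sum big1 => [|i _]; last by rewrite !mulr0 subrr mulr0.
    by rewrite sub0r normrN set_itv1 Rintegral_set1 subr0.
  by move=> /cvg_lim => <- //; rewrite lim_cst.
apply: (@negligibleS _ _ _ _ (\bigcup_n [set w | n.+1%:R^-1 <= `|Z w|])).
  move=> w /= /eqP Xw; have Z0 : 0 < `|Z w|.
    rewrite normr_gt0; apply: contra Xw => /eqP; rewrite /Z => Zw; apply/eqP; lra.
  have [n _ nZ] : exists2 n, True & n.+1%:R^-1 <= `|Z w|.
    have [n nZ] := ltr_add_invr Z0.
    by exists n => //; rewrite add0r in nZ; exact: ltW.
  by exists n.
by apply: negligible_bigcup => n; apply/negligibleP => //; exact: PA.
Qed.

End shifted_controls.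

Section restart_at_threshold.
Context {R : realType} {d : measure_display} {T : measurableType d}.
Variable P : probability T R.
Implicit Types (F : R -> set (set T)) (W X U D : R -> T -> R).

Lemma le_expected_cost (c : R -> R) (qu qd : R) U D U' D' X (J : set T)
    (k S : R) :
  (forall y, 0 <= c y) -> 0 <= qu -> 0 <= qd -> 0 <= k ->
  (forall w, [/\ 0 <= U S w, 0 <= D S w, 0 <= U' S w & 0 <= D' S w]) ->
  measurable J -> P (~` J) = 0%E ->
  (forall w, J w -> qu * U S w + qd * D S w <= qu * U' S w + qd * D' S w + k) ->
  (expected_cost P c qu qd U D X S <= expected_cost P c qu qd U' D' X S + k%:E)%E.
Proof.
move=> c0 qu0 qd0 k0 pos mJ PJ le.
have i0 w : 0 <= \int[lebesgue_measure]_(s in `[0, S]) c (X s w).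
  exact: Rintegral_ge0.
apply: (ae_le_integral_addcst _ J) => // w.
- by have [? ? _ _] := pos w; rewrite lee_fin !addr_ge0// mulr_ge0.
- by have [_ _ ? ?] := pos w; rewrite lee_fin !addr_ge0// mulr_ge0.
- by move=> /le Jw; rewrite -EFinD lee_fin -!addrA lerD2l !addrA.
Qed.

(** A bounded extra cost contributes [k / S], which is at most [e] once [S >= k / e]. *)
Lemma le_long_run_cost (c : R -> R) (qu qd : R) U D U' D' X (k : R) :
  0 <= k ->
  (forall S : R, 0 <= S -> (expected_cost P c qu qd U D X S <=
                            expected_cost P c qu qd U' D' X S + k%:E)%E) ->
  (long_run_cost P c qu qd U D X <= long_run_cost P c qu qd U' D' X)%E.
Proof.
move=> k0 le; apply: le_limf_esup_near => e e0; near=> S.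
have S0 : 0 < S by near: S; exact: nbhs_pinfty_gt.
have kS : k / e <= S by near: S; exact: nbhs_pinfty_ge (num_real _).
apply: (@le_trans _ _ ((S^-1)%:E * (expected_cost P c qu qd U' D' X S + k%:E))%E).
  by apply: lee_wpmul2l; [rewrite lee_fin invr_ge0 ltW|exact: (le _ (ltW S0))].
rewrite muleDr//; last exact: fin_num_adde_defl.
rewrite leeD2l// -EFinM lee_fin mulrC ler_pdivrMr//.
by rewrite -ler_pdivrMl// mulrC.
Unshelve. all: by end_near. Qed.

(** Brings any policy within reach of the cost formula, which is available only for starting points
    in [[a, b]]. *)
Lemma reflection_policy_restart (mu sigma c : R -> R) (qu qd : R) F W
    (x a b : R) U D X :
  (forall y, 0 <= c y) -> 0 <= qu -> 0 <= qd -> complete_filtration P F ->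
  reflection_policy P mu sigma F W x a b U D X ->
  exists x' U' D', [/\ a <= x' <= b,
    reflection_policy P mu sigma F W x' a b U' D' X &
    long_run_cost P c qu qd U' D' X = long_run_cost P c qu qd U D X].
Proof.
move=> c0 qu0 qd0 cF pol.
have ab := reflection_lt pol.
have aU := reflection_up pol; have aD := reflection_down pol.
have sX := reflection_state pol.
(* The jumps needed to bring [x] up to [a] or down to [b]; at most one is nonzero. *)
pose ku := Num.max (a - x) 0; pose kd := Num.max (x - b) 0.
have ku0 : 0 <= ku by rewrite le_max lexx orbT.
have kd0 : 0 <= kd by rewrite le_max lexx orbT.
pose J := [set w | ku <= U 0 w] `&` [set w | kd <= D 0 w].
have JU : J `<=` [set w | ku <= U 0 w] by move=> w [].
have JD : J `<=` [set w | kd <= D 0 w] by move=> w [].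
have preimE (Y : R -> T -> R) (k : R) : [set w | k <= Y 0 w] = Y 0 @^-1` `[k, +oo[.
  by apply/seteqP; split => w /=; rewrite in_itv/= andbT.
have FJ : F 0 J.
  apply: sigma_algebra_setI; first exact: (filtration_sigma cF (lexx 0)).
    by rewrite preimE; exact: (control_adapted aU).
  by rewrite preimE; exact: (control_adapted aD).
have mJ : measurable J by exact: (filtration_sub cF (lexx 0) FJ).
(* Almost surely [x + U 0 - D 0] lies in [[a, b]]; as both controls are nonnegative, [U 0 >= a - x]
   and [D 0 >= x - b]. *)
have PJ : P (~` J) = 0%E.
  apply/negligibleP; first exact: measurableC.
  have := state_at_0 P mu sigma F W x U D X cF aU aD sX.
  have := reflection_between pol.
  apply: filterS2 => w /(_ 0 (lexx 0)) Xw X0; rewrite /J /ku /kd /=.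
  have := control_ge0 F U aU 0 w; have := control_ge0 F D aD 0 w.
  by split; rewrite ge_max; apply/andP; split => //; lra.
(* With the constants crossed, [U' - D' = U - D - ku + kd] both on and off [J], matching the new
   start [x + ku - kd]. *)
pose U' := shift_control J ku kd U; pose D' := shift_control J kd ku D.
have aU' : admissible_control F U'.
  exact: shift_control_admissible cF FJ JU ku0 kd0 aU.
have aD' : admissible_control F D'.
  exact: shift_control_admissible cF FJ JD kd0 ku0 aD.
exists (x + ku - kd), U', D'; split.
- by rewrite /ku /kd; case: (leP (a - x) 0); case: (leP (x - b) 0); lra.
- split => //.
  + split; [exact: (state_adapted sX)|exact: (state_cadlag sX)|move=> t t0].
    have := state_sde sX t0; congr is_ito_integral; apply/funext => w.
    by rewrite /U' /D' /shift_control ltNge t0/=; case: ifP => _; ring.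
  + exact: (reflection_between pol).
  + have := reflection_continuous pol; apply: filterS => w cUD t t0.
    by have [cU cD] := cUD t t0; split; exact: shift_control_continuous.
  + have aeJ : {ae P, forall w, J w} by apply/negligibleP => //; exact: measurableC.
    have := reflection_up_at pol; apply: filterS2 aeJ => w Jw upw t t0 inc.
    apply: upw => //; exact: (shift_control_point F U J ku kd t w aU ku0 JU Jw).
  + have aeJ : {ae P, forall w, J w} by apply/negligibleP => //; exact: measurableC.
    have := reflection_down_at pol; apply: filterS2 aeJ => w Jw downw t t0 inc.
    apply: downw => //; exact: (shift_control_point F D J kd ku t w aD kd0 JD Jw).
- have pos S w : [/\ 0 <= U' S w, 0 <= D' S w, 0 <= U S w & 0 <= D S w].
    by split; [exact: (control_ge0 F)..].
  have JE S w : 0 <= S -> J w -> U' S w = U S w - ku /\ D' S w = D S w - kd.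
    by move=> S0 /mem_set Jw; rewrite /U' /D' /shift_control Jw ltNge S0.
  have nn : 0 <= qu * ku + qd * kd by rewrite addr_ge0// mulr_ge0.
  (* Removing the jump does not raise the cost, and restoring it adds at most
     [qu * ku + qd * kd]. *)
  apply/eqP; rewrite eq_le; apply/andP; split.
    apply: (le_long_run_cost _ _ _ _ _ _ _ _ 0) => // S S0.
    apply: (le_expected_cost _ _ _ _ _ _ _ _ J) => // w Jw.
    by have [-> ->] := JE S w S0 Jw; rewrite addr0 !mulrBr lerD// gerBl mulr_ge0.
  apply: (le_long_run_cost _ _ _ _ _ _ _ _ _ nn) => S S0.
  apply: (le_expected_cost _ _ _ _ _ _ _ _ J) => // w.
    by have [] := pos S w.
  by move=> Jw; have [-> ->] := JE S w S0 Jw; lra.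
Qed.

End restart_at_threshold.

(** * Optimality of the threshold pair among reflection policies *)

Theorem theorem2p5 (R : realType)
  (* the coefficients of the diffusion *)
  (mu sigma : R -> R)
  (mu_cont : continuous mu)
  (sigma_cont : continuous sigma)
  (sigma_ge0 : forall x, 0 <= sigma x)
  (sigma2_gt0 : forall x, 0 < sigma x ^+ 2)
  (loc_int : locally_integrable setT
    (fun x => (1 + `|mu x|) / sigma x ^+ 2))
  (* the costs *)
  (c : R -> R)
  (c_cont : continuous c)
  (c_ge : forall x, c 0 <= c x)
  (c0_ge0 : 0 <= c 0)
  (qu qd : R) (qu_ge0 : 0 <= qu) (qd_ge0 : 0 <= qd)
  (xh1 xh2 : R)
  (xh1_argmin : unique_argmin (pi1 mu c qd) xh1)
  (xh2_argmin : unique_argmin (pi2 mu c qu) xh2)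
  (pi1_shape : decreasing_then_increasing (pi1 mu c qd) xh1)
  (pi2_shape : decreasing_then_increasing (pi2 mu c qu) xh2)
  (pi1_lim : pi1 mu c qd x @[x --> +oo%R] --> +oo%R)
  (pi2_lim : pi2 mu c qu x @[x --> -oo%R] --> +oo%R)
  (* the lower limit in the definition of the scale density *)
  (x0 : R)
  (* the thresholds *)
  (astar bstar : R)
  (astar_lt : astar < xh2) (bstar_gt : xh1 < bstar)
  (star_system : threshold_system mu sigma c qu qd x0 astar bstar)
  (star_unique : forall a b : R, a < xh2 -> xh1 < b ->
    threshold_system mu sigma c qu qd x0 a b -> a = astar /\ b = bstar)
  (* the stochastic basis *)
  (d : measure_display) (T : measurableType d) (P : probability T R)
  (F : R -> set (set T)) (F_filtration : complete_filtration P F)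
  (W : R -> T -> R) (W_bm : brownian_motion P F W) :
  [/\ global_minimum (average_cost mu sigma c qu qd x0) astar bstar,
      (forall a b lambda lambdastar : R, a < b ->
        lambda = average_cost mu sigma c qu qd x0 a b ->
        lambdastar = average_cost mu sigma c qu qd x0 astar bstar ->
        lambdastar <= lambda)
    & (* C(a, b) is the long-run average cost of (U^a, D^b) for x in [a, b] *)
      (forall (x a b : R) (U D X : R -> T -> R), a <= x <= b ->
        reflection_policy P mu sigma F W x a b U D X ->
        long_run_cost P c qu qd U D X =
        (average_cost mu sigma c qu qd x0 a b)%:E) ->
      (* for every starting point, in [astar, bstar] or not *)
      forall (x : R) (U D X : R -> T -> R),
        reflection_policy P mu sigma F W x astar bstar U D X ->
        optimal_among_reflections P mu sigma c qu qd F W x U D X].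
Proof.
have min := average_cost_min mu sigma c qu qd x0 xh1 xh2 astar bstar
  mu_cont sigma_cont sigma2_gt0 c_cont qu_ge0 qd_ge0 xh1_argmin xh2_argmin
  pi1_shape pi2_shape astar_lt bstar_gt star_system.
split; first exact: min.
  by move=> a b _ _ ab -> ->; exact: (proj2 min).
move=> costE x U D X pol; split; first by exists astar, bstar.
have c_ge0 y : 0 <= c y by exact: le_trans (c_ge y).
move=> a b U1 D1 X1 pol1.
(* Each policy is restarted inside its own interval. The new starting points may differ, but the
   cost formula does not depend on them. *)
have [y [V [E [yab polV <-]]]] := reflection_policy_restart P mu sigma c qu qd
  F W x astar bstar U D X c_ge0 qu_ge0 qd_ge0 F_filtration pol.
have [y1 [V1 [E1 [y1ab polV1 <-]]]] := reflection_policy_restart P mu sigma c qu qd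
  F W x a b U1 D1 X1 c_ge0 qu_ge0 qd_ge0 F_filtration pol1.
rewrite (costE y astar bstar)// (costE y1 a b)// lee_fin.
exact: (proj2 min _ _ (reflection_lt pol1)).
Qed.
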